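(* Let $G=(S,\mathcal{F})$ be an arbitrary greedoid with set of bases $\mathcal{B}$ and let $w:\mathcal{F}\rightarrow\mathbb{R}$ be an objective function that fulfills the following property: whenever $A\subseteq B$, $A\in\mathcal{F}$, $B\in\mathcal{B}$, $x\in S-B$, $A+x\in\mathcal{F}$, and $w(A+x)\ge w(A+u)$ for every $u\in\Gamma(A)$, there exists a $y\in B-A$ such that $B-y+x\in\mathcal{B}$ and $w(B-y+x)\ge w(B)$. Then the greedy algorithm gives a maximum base with respect to $w$, that is, a base $B^*\in\mathcal{B}$ with $w(B^* )\ge w(B)$ for all $B\in\mathcal{B}$.
   Context: Notation: $X+x=X\cup\{x\}$, $X-x=X\setminus\{x\}$, $X-Y=X\setminus Y$. A greedoid $G=(S,\mathcal{F})$ consists of a finite ground set $S$ and a family $\mathcal{F}\subseteq 2^S$ (the feasible sets) such that $\emptyset\in\mathcal{F}$, and whenever $X,Y\in\mathcal{F}$ with $|X|<|Y|$ there is $y\in Y-X$ with $X+y\in\mathcal{F}$. A base of $G$ is a feasible set of maximum size; $\mathcal{B}$ denotes the set of bases. For $A\in\mathcal{F}$, the set of continuations is $\Gamma(A)=\{x\in S-A : A+x\in\mathcal{F}\}$. Greedy algorithm (for maximizing $w$ over bases): start with $A=\emptyset$. While $\Gamma(A)\ne\emptyset$, choose an $x\in\Gamma(A)$ such that $w(A+x)\ge w(A+y)$ for every $y\in\Gamma(A)$ (ties broken arbitrarily) and replace $A$ by $A+x$. When $\Gamma(A)=\emptyset$, stop and output $A$. The statement that the greedy algorithm gives a maximum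 base means that every legal run (any tie-breaking) outputs one. *)

(* Defs.v *)
From HB Require Import structures.
From mathcomp Require Import all_boot all_order all_algebra.
From mathcomp Require Import reals.

Set Implicit Arguments.
Unset Strict Implicit.
Unset Printing Implicit Defensive.

Import Order.TTheory GRing.Theory Num.Theory.
Local Open Scope ring_scope.

(* The ground set is the whole finite type S; X + x is x |: X and X - x is X :\ x. *)
Record greedoid (S : finType) := Greedoid {
  feasible : {set {set S}};
  feasible0 : set0 \in feasible;
  feasible_exchange : forall X Y : {set S},
    X \in feasible -> Y \in feasible -> (#|X| < #|Y|)%N ->
    exists2 y, y \in Y :\: X & y |: X \in feasible }.

Definition bases (S : finType) (G : greedoid S) : {set {set S}} :=
  [set B in feasible G | [forall X in feasible G, (#|X| <= #|B|)%N]].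

Definition continuations (S : finType) (G : greedoid S) (A : {set S}) : {set S} :=
  [set x | (x \notin A) && (x |: A \in feasible G)].

(* An objective function on the feasible sets is represented by a total
   function on {set S}; below, its values are used at feasible sets only. *)

Definition greedy_choice (R : realType) (S : finType) (G : greedoid S)
    (w : {set S} -> R) (A : {set S}) (x : S) : Prop :=
  x \in continuations G A /\
  (forall y, y \in continuations G A -> w (y |: A) <= w (x |: A)).

Inductive greedy_reachable (R : realType) (S : finType) (G : greedoid S)
    (w : {set S} -> R) : {set S} -> Prop :=
| greedy_start : greedy_reachable G w set0
| greedy_step (A : {set S}) (x : S) :
    greedy_reachable G w A -> greedy_choice G w A x ->
    greedy_reachable G w (x |: A).

Definition greedy_output (R : realType) (S : finType) (G : greedoid S)
    (w : {set S} -> R) (A : {set S}) : Prop :=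
  greedy_reachable G w A /\ continuations G A = set0.

Definition maximum_base (R : realType) (S : finType) (G : greedoid S)
    (w : {set S} -> R) (B : {set S}) : Prop :=
  B \in bases G /\ (forall B' : {set S}, B' \in bases G -> w B' <= w B).

(* The next two facts say that a run cannot get stuck and cannot go on
   forever; hence every run ends with some A such that greedy_output G w A. *)

Lemma greedy_progress (R : realType) (S : finType) (G : greedoid S)
    (w : {set S} -> R) (A : {set S}) :
  continuations G A <> set0 -> exists x, greedy_choice G w A x.
Proof.
move=> /eqP/set0Pn[x0 x0A].
case: (@Order.TotalTheory.arg_maxP _ _ _ x0 (mem (continuations G A))
  (fun x => w (x |: A)) x0A) => x xA xmax.
by exists x; split=> // y /xmax.
Qed.

Lemma greedy_step_card (R : realType) (S : finType) (G : greedoid S)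
    (w : {set S} -> R) (A : {set S}) (x : S) :
  greedy_choice G w A x -> (#|A| < #|x |: A| <= #|S|)%N.
Proof.
case; rewrite inE => /andP[xA _] _.
by rewrite max_card andbT cardsU1 xA.
Qed.

(* Main.v *)
Require Import Defs.
From mathcomp Require Import all_boot all_order all_algebra.
From mathcomp Require Import reals.

(* Along a run, every base B0 is dominated by some base containing the current
   set A: adding the greedy element x to A keeps this true, since a dominating
   base that misses x can be repaired by the exchange hypothesis at an element
   outside A. When the run stops, the augmentation property forces the
   dominating base to be A itself. *)

Local Open Scope ring_scope.

Import Order.TTheory.

Lemma bases_exist (S : finType) (G : greedoid S) : exists B, B \in bases G.
Proof.
case: (@arg_maxnP _ set0 (mem (feasible G)) (fun X : {set S} => #|X|)
  (feasible0 G)) => B FB Bmax.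
exists B; rewrite inE; apply/andP; split; first exact: FB.
by apply/forall_inP => X /Bmax.
Qed.

Lemma greedy_reachable_feasible (R : realType) (S : finType) (G : greedoid S)
    (w : {set S} -> R) (A : {set S}) :
  greedy_reachable G w A -> A \in feasible G.
Proof.
case=> [|{}A x _ [+ _]]; first exact: feasible0.
by rewrite inE => /andP[].
Qed.

(** If [A] were smaller than [B], exchange would supply an element of [B :\: A] that is a
    continuation of [A]. *)
Lemma continuations0_sub_base (S : finType) (G : greedoid S) (A B : {set S}) :
  A \in feasible G -> continuations G A = set0 -> B \in bases G ->
  A \subset B -> A = B.
Proof.
move=> FA stuck; rewrite inE => /andP[FB _] AB.
apply/eqP; rewrite eqEcard AB leqNgt; apply/negP => ltAB.
have [y] := feasible_exchange FA FB ltAB.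
rewrite inE => /andP[yA _] FyA.
by have := in_set0 y; rewrite -stuck inE yA FyA.
Qed.

Theorem theorem13 (R : realType) (S : finType) (G : greedoid S)
    (w : {set S} -> R)
    (hw : forall (A B : {set S}) (x : S),
        A \subset B -> A \in feasible G -> B \in bases G ->
        x \notin B -> x |: A \in feasible G ->
        (forall u, u \in continuations G A -> w (u |: A) <= w (x |: A)) ->
        exists y, [/\ y \in B :\: A, x |: (B :\ y) \in bases G
                    & w B <= w (x |: (B :\ y))]) :
  forall A : {set S}, greedy_output G w A -> maximum_base G w A.
Proof.
move=> A [reachA stuck].
have dominated B0 : B0 \in bases G ->
    exists B, [/\ B \in bases G, A \subset B & w B0 <= w B].
  move=> B0base; elim: reachA => [|{stuck} {}A x reachA [B [Bbase AB leB]] []].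
    by exists B0; rewrite sub0set.
  rewrite inE => /andP[xA FxA] xmax.
  have [xB|xB] := boolP (x \in B).
    by exists B; rewrite subUset sub1set xB AB.
  have FA : A \in feasible G by apply: greedy_reachable_feasible reachA.
  have [y [+ B'base leB']] := hw A B x AB FA Bbase xB FxA xmax.
  rewrite inE => /andP[yA _].
  exists (x |: (B :\ y)); split=> //; last exact: le_trans leB leB'.
  (* As [y] is outside [A], the set [B :\ y] still contains [A]; adding [x] to both keeps the
     inclusion. *)
  by rewrite setUS // subsetD1 AB.
have eqA B : B \in bases G -> A \subset B -> A = B.
  by apply: continuations0_sub_base stuck; apply: greedy_reachable_feasible reachA.
split=> [|B0 /dominated[B [Bbase AB leB]]]; last by rewrite (eqA B).
(* That [A] is itself a base needs some base to start from; any one is dominated by a base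
   containing [A], which equals [A]. *)
have [B0 /dominated[B [Bbase AB _]]] := bases_exist _ G.
by rewrite (eqA B).
Qed.
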